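(* Let $f:\{0,1\}^r\to\{0,1\}$ be the dictator $f(x)=x_j$ for a fixed $j\in[r]$. For $N\ge2$ and $1\le s\le N-1$ put $\varphi(s)=\mathbb{E}[T\mid S_0=s]$ and $p_0=s/N$. Then: (a) $\varphi(s)/N^2=\mathrm{Ent}(p_0)+O(1/N)$ uniformly over $1\le s\le N-1$, with implied constant $3$, i.e. $|\varphi(s)/N^2-\mathrm{Ent}(s/N)|\le 3/N$. In particular $\varphi(s)/N^2\to \mathrm{Ent}(p)$ as $N\to\infty$ for fixed $p\in(0,1)$ and $s=\lfloor pN\rfloor$, and $\varphi(s)=\Theta(N^2)$ uniformly over the $s$ with $p_0$ bounded away from $\{0,1\}$. (b) $\varphi(1)=NH_{N-1}=\Theta(N\log N)$, and symmetrically $\varphi(N-1)=NH_{N-1}$. (c) More generally, $\varphi(s)=\Theta\bigl(Ns\log(N/s)\bigr)$ in the regime $1\le s=o(N)$ (as $N\to\infty$). (d) There are absolute constants $0<c\le C<\infty$ such that $$c\,N^2\,\mathrm{Ent}(p_0)\le\varphi(s)\le C\,N^2\,\mathrm{Ent}(p_0)\qquad\text{for every }N\ge2\text{ and every }1\le s\le N-1;$$ one may take $c=1/6$ and $C=2$.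
   Context: Consider the discrete-time Markov chain $X^{(t)}\in\{0,1\}^N$ whose step is: draw $V$ uniform on $[N]=\{1,\dots,N\}$; draw $J_1,\dots,J_r$ i.i.d. uniform on $[N]$, independent of $V$ (all fresh at each step); set $X^{(t+1)}_V=f(X^{(t)}_{J_1},\dots,X^{(t)}_{J_r})$ and leave every other coordinate unchanged. $T=\inf\{t: X^{(t)}\text{ is constant}\}$ and $S_t=\#\{i:X_i^{(t)}=1\}$, itself a Markov chain. $H_n=\sum_{l=1}^n 1/l$ for $n\ge1$, $H_0=0$. $\log$ is the natural logarithm and $\mathrm{Ent}(p)=-p\log p-(1-p)\log(1-p)$. *)

(* Defs.v *)
From HB Require Import structures.
From mathcomp Require Import all_boot all_order all_algebra.
From mathcomp Require Import all_classical all_reals all_analysis.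

Set Implicit Arguments.
Unset Strict Implicit.
Unset Printing Implicit Defensive.

Import Order.TTheory GRing.Theory Num.Theory.
Import numFieldNormedType.Exports.

Local Open Scope classical_set_scope.
Local Open Scope ring_scope.

(* {0,1}^n, with [true] standing for 1; the coordinates [N] = {1, ..., N} are
   represented by 'I_N = {0, ..., N-1}. *)
Definition config (n : nat) := {ffun 'I_n -> bool}.

Definition dictator (r : nat) (j : 'I_r) (x : config r) : bool := x j.

Definition ones (n : nat) (x : config n) : nat := #|[set i | x i]%SET|.

Definition is_constant (n : nat) (x : config n) : Prop :=
  exists b : bool, forall i, x i = b.

Definition update (r n : nat) (f : config r -> bool)
    (v : 'I_n) (u : 'I_r -> 'I_n) (x : config n) : config n :=
  [ffun i => if i == v then f [ffun k => x (u k)] else x i].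

(* A realization of the chain on a probability space: [V t] and [J t k] are the
   draws used by the step from time t to time t + 1, and the initial state
   [X 0] may be random. All variables take finitely many values, so their
   measurability is that of the atoms, and [chain_indep] (for every horizon m)
   is the mutual independence of [X 0] and of all the draws. *)
Record is_chain (R : realType) (r n : nat) (f : config r -> bool)
    (d : measure_display) (Om : measurableType d) (P : probability Om R)
    (X : nat -> Om -> config n) (V : nat -> Om -> 'I_n)
    (J : nat -> 'I_r -> Om -> 'I_n) : Prop := IsChain {
  chain_meas_init : forall x, measurable [set w | X 0%N w = x];
  chain_meas_V : forall t v, measurable [set w | V t w = v];
  chain_meas_J : forall t k u, measurable [set w | J t k w = u];
  chain_unif_V : forall t v, P [set w | V t w = v] = (n%:R^-1)%:E;
  chain_unif_J : forall t k u, P [set w | J t k w = u] = (n%:R^-1)%:E;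
  chain_indep : forall (m : nat) (x : config n)
      (v : 'I_m -> 'I_n) (u : 'I_m -> 'I_r -> 'I_n),
    (P [set w | X 0%N w = x /\
         forall t : 'I_m, V t w = v t /\ forall k, J t k w = u t k]
     = P [set w | X 0%N w = x] *
       \prod_(t < m) (P [set w | V t w = v t] *
                      \prod_(k < r) P [set w | J t k w = u t k]))%E;
  chain_step : forall t w,
    X t.+1 w = update f (V t w) (fun k => J t k w) (X t w)
}.

(* T = inf {t : X t is constant}, equal to +oo if there is no such t. *)
Definition absorption_time (R : realType) (n : nat) (Om : Type)
    (X : nat -> Om -> config n) (w : Om) : \bar R :=
  ereal_inf [set (t%:R)%:E | t in [set t : nat | is_constant (X t w)]].

(* [e] is E[T | S_0 = s], the conditional expectation given an event of positive
   probability, computed in some realization of the chain on n coordinates.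
   No finiteness is presupposed, hence [e : \bar R]. *)
Definition mean_absorption_time (R : realType) (r n : nat)
    (f : config r -> bool) (s : nat) (e : \bar R) : Prop :=
  exists (d : measure_display) (Om : measurableType d) (P : probability Om R)
      (X : nat -> Om -> config n) (V : nat -> Om -> 'I_n)
      (J : nat -> 'I_r -> Om -> 'I_n),
    let S0_eq_s := [set w | ones (X 0%N w) = s] in
    [/\ is_chain f P X V J,
        (0 < P S0_eq_s)%E &
        e = ((\int[P]_(w in S0_eq_s) absorption_time R X w) / P S0_eq_s)%E].

Definition Ent (R : realType) (p : R) : R :=
  - p * ln p - (1 - p) * ln (1 - p).

Definition harmonic_number (R : realType) (n : nat) : R :=
  \sum_(1 <= l < n.+1) l%:R^-1.

(* Main.v *)
Require Import Defs.
From HB Require Import structures.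
From mathcomp Require Import all_boot all_order all_algebra.
From mathcomp Require Import all_classical all_reals all_analysis.
From mathcomp Require Import ring lra zify.

(** With a dictator rule a step copies the value of a uniform coordinate onto
    another uniform coordinate, so [k = ones (X t)] moves up or down by one with
    the same probability [k * (N - k) / N ^+ 2] and is absorbed at [0] and [N].
    A mean absorption time has to solve the Poisson equation with second
    difference [- N ^+ 2 / (k * (N - k))] and zero boundary values. Since
    [1 / k + 1 / (N - k) = N / (k * (N - k))] and [m * (H_N - H_m)] has second
    difference [- 1 / m], the solution is
    [N * (k * (H_N - H_k) + (N - k) * (H_N - H_(N - k)))],
    called [voter_time] below ([voter_time_poisson], [voter_time_drift]).

    To identify it with the conditional expectation, let [b_m] be the probability
    that [S_0 = s] and that the chain is not yet constant at time [m]. The mean of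
    [voter_time N (ones (X m))] on the event [S_0 = s] drops by [b_m] at
    step [m], because the draws of that step are independent of the past
    ([mean_step], [pr_past_draw]). This mean is at most a constant times [b_m] in
    absolute value. Hence the partial sums of [b] are bounded, so [b_m] and then
    the mean itself tend to [0], and the series [b] sums to
    [P(S_0 = s) * voter_time N s] ([cvg_series_unsettled]); that [T] is finite
    almost surely on [S_0 = s] comes as a by-product. Constant configurations are
    absorbing, so [T] is the number of times at which the chain is not constant,
    and monotone convergence turns the sum into the integral of [T]
    ([integral_absorption_time], [mean_absorption_timeE]).

    All the estimates then compare [H_N - H_s], a sum of [1 / l] over
    [s < l <= N], with [ln (N / s)]. Replacing harmonic gaps by logarithms turns
    [voter_time N s] into [N ^+ 2 * Ent (s / N)]. The logarithm is the larger
    one, exceeds the gap by at most [1 / s] (which costs [N] in each of the two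
    terms), and is at most twice the gap. This gives
    [N ^+ 2 * Ent - 2 * N <= voter_time N s <= N ^+ 2 * Ent] and
    [N ^+ 2 * Ent <= 2 * voter_time N s], which carry all the asymptotic statements;
    the values at [1] and [N - 1] can be read off the formula. *)

Set Implicit Arguments.
Unset Strict Implicit.
Unset Printing Implicit Defensive.

Import Order.TTheory GRing.Theory Num.Theory.
Import numFieldNormedType.Exports.

Local Open Scope classical_set_scope.
Local Open Scope ring_scope.

(** * Harmonic numbers, logarithms and the Poisson equation *)

Section Harmonic.
Context {R : realType}.
Implicit Types n s N : nat.
Local Notation H := (harmonic_number R).
Local Notation L n := (ln (n%:R : R)).
Local Notation I n := ((n%:R : R)^-1).

Lemma harmonic_numberS n : H n.+1 = H n + I n.+1.
Proof. by rewrite /harmonic_number big_nat_recr. Qed.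

(** [ln (1 + x) <= x] at [x = 1 / n] and at [x = - 1 / n.+1]. *)
Lemma ln_natS_bounds n : (0 < n)%N ->
  I n.+1 <= L n.+1 - L n <= I n .
Proof.
move=> n_gt0.
have n0 : 0 < n%:R :> R by rewrite ltr0n.
have n10 : 0 < n.+1%:R :> R by rewrite ltr0n.
have nE : n.+1%:R = n%:R + 1 :> R by rewrite -natr1.
have iN : I n.+1 <= 1 :> R by rewrite invf_le1// ler1n.
rewrite -ln_div ?posrE//; apply/andP; split; last first.
  have -> : n.+1%:R / n%:R = 1 + I n :> R.
    by rewrite nE mulrDl divff ?gt_eqF// mul1r.
  by apply: le_ln1Dx; rewrite (lt_trans (ltrN10 _))// invr_gt0.
have -> : n.+1%:R / n%:R = (1 - I n.+1)^-1 :> R.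
  have -> : 1 - I n.+1 = n%:R / n.+1%:R :> R.
    by rewrite nE; field; rewrite -nE gt_eqF.
  by rewrite invf_div.
rewrite lnV; last first.
  rewrite posrE subr_gt0 invf_lt1// ltr1n; lia.
rewrite lerNr; apply: le_ln1Dx.
by rewrite ltrN2 invf_lt1// ltr1n; lia.
Qed.

(** [1 / s - 1 / N] is the difference of the two Riemann sums of [1 / x] on the
    unit subdivision of [[s, N]], which enclose the integral. *)
Lemma harmonic_gap_bounds s N : (1 <= s <= N)%N ->
  L N - L s - (I s - I N) <= H N - H s <= L N - L s.
Proof.
move=> /andP[s1 sN]; rewrite -(subnKC sN); elim: (N - s)%N => [|d IH].
  by rewrite addn0 !subrr lexx.
rewrite addnS harmonic_numberS.
have /ln_natS_bounds/andP[lo hi] : (0 < s + d)%N by lia.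
case/andP: IH; move: (I s) (I (s + d)) (I (s + d).+1) lo hi => a b c *.
by apply/andP; split; lra.
Qed.

(** [ln l - ln (l - 1) <= 1 / (l - 1) <= 2 / l] for [l >= 2]. A multiplicative
    bound is what the parts uniform in [s] need: near the ends of the range the
    additive error [2 * N] is not small compared with [N ^+ 2 * Ent (s / N)]. *)
Lemma ln_le_harmonic_gap s N : (1 <= s <= N)%N ->
  L N - L s <= 2 * (H N - H s).
Proof.
move=> /andP[s1 sN]; rewrite -(subnKC sN); elim: (N - s)%N => [|d IH].
  by rewrite addn0 !subrr mulr0.
rewrite addnS harmonic_numberS.
have sd0 : (0 < s + d)%N by lia.
have /andP[_] := ln_natS_bounds sd0.
have : (I (s + d) <= 2 * I (s + d).+1 :> R).
  rewrite -[leRHS]invrK lef_pV2 ?posrE ?ltr0n ?invr_gt0 ?mulr_gt0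
    ?invr_gt0 ?ltr0n//.
  by rewrite invfM invrK mulrC ler_pdivrMr// -natrM ler_nat; lia.
by move: (I (s + d)) (I (s + d).+1) IH => a b *; lra.
Qed.

(** The expected consensus time; its normalisation by [N ^+ 2] is the entropy
    with the logarithms replaced by harmonic numbers. *)
Definition voter_time N s : R :=
  N%:R * (s%:R * (H N - H s) + (N - s)%:R * (H N - H (N - s))).

(** The chain is invariant under the exchange of zeros and ones. *)
Lemma voter_timeC N s : (s <= N)%N -> voter_time N (N - s) = voter_time N s.
Proof. by move=> sN; rewrite /voter_time subKn// addrC. Qed.

Lemma voter_time0 N : voter_time N 0 = 0.
Proof. by rewrite /voter_time subn0 subrr mulr0 mul0r addr0 mulr0. Qed.

Lemma voter_timeN N : voter_time N N = 0.
Proof. by rewrite -(voter_time0 N) -[RHS]voter_timeC// subn0. Qed.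

Lemma voter_time1 N : (2 <= N)%N -> voter_time N 1 = N%:R * H (N - 1).
Proof.
case: N => [//|N] N1; rewrite /voter_time subn1 /= harmonic_numberS.
have -> : H 1 = 1 by rewrite /harmonic_number big_nat1 invr1.
congr (_ * _); have : N.+1%:R != 0 :> R by rewrite pnatr_eq0.
by rewrite -natr1 => ?; field.
Qed.

(** [m * (H N - H m)] is concave in [m] with second difference [- 1 / m], and
    [1 / s + 1 / (N - s) = N / (s * (N - s))]. *)
Lemma voter_time_poisson N s : (0 < s < N)%N ->
  (s * (N - s))%:R * (voter_time N s.+1 - voter_time N s) +
  (s * (N - s))%:R * (voter_time N s.-1 - voter_time N s) = - N%:R ^+ 2.
Proof.
case: s => [//|s] /andP[_ sN].
have [m ->] : exists m, N = (s + m.+2)%N by exists (N - s.+2)%N; lia.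
rewrite /voter_time /=.
rewrite (_ : s + m.+2 - s.+1 = m.+1)%N; last by lia.
rewrite (_ : s + m.+2 - s.+2 = m)%N; last by lia.
rewrite (_ : s + m.+2 - s = m.+2)%N; last by lia.
move: (H _) => HN; rewrite !harmonic_numberS natrM natrD -!natr1.
have := ltr0Sn R s; have := ltr0Sn R m.
have := ltr0Sn R s.+1; have := ltr0Sn R m.+1.
rewrite -!natr1 => /lt0r_neq0 ? /lt0r_neq0 ? /lt0r_neq0 ? /lt0r_neq0 ?.
by field; do !(apply/andP; split).
Qed.

Lemma Ent_nat N s : (0 < s < N)%N ->
  N%:R * Ent (s%:R / N%:R) = s%:R * (L N - L s) +
    (N - s)%:R * (L N - L (N - s)) :> R.
Proof.
move=> /andP[s0 sN]; rewrite /Ent.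
have N_gt0 : (0 < N)%N by exact: leq_ltn_trans sN.
have N0 : 0 < N%:R :> R by rewrite ltr0n.
have -> : 1 - s%:R / N%:R = (N - s)%:R / N%:R :> R.
  by rewrite natrB 1?ltnW// mulrBl divff ?gt_eqF.
rewrite !ln_div ?posrE ?ltr0n ?subn_gt0//.
by rewrite natrB 1?ltnW//; field; rewrite gt_eqF.
Qed.

Lemma voter_time_le_Ent N s : (0 < s < N)%N ->
  voter_time N s <= N%:R ^+ 2 * Ent (s%:R / N%:R).
Proof.
move=> sN; rewrite expr2 -mulrA Ent_nat// ler_wpM2l// lerD// ler_wpM2l//.
  by have /harmonic_gap_bounds/andP[] : (1 <= s <= N)%N by lia.
by have /harmonic_gap_bounds/andP[] : (1 <= N - s <= N)%N by lia.
Qed.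

(** A gap is short of its logarithm by at most [1 / k], and is weighted by [k]. *)
Lemma Ent_sub_le_voter_time N s : (0 < s < N)%N ->
  N%:R ^+ 2 * Ent (s%:R / N%:R) - 2 * N%:R <= voter_time N s.
Proof.
move=> sN; rewrite expr2 -mulrA Ent_nat// [2 * _]mulrC -mulrBr ler_wpM2l//.
have gap k : (1 <= k <= N)%N ->
    k%:R * (L N - L k) - 1 <= k%:R * (H N - H k) :> R.
  move=> kN; have /andP[hk _] := harmonic_gap_bounds kN.
  have k0 : 0 < k%:R :> R by rewrite ltr0n; lia.
  rewrite lerBlDr -[X in _ <= _ + X](@mulfV _ k%:R) ?gt_eqF// -mulrDr ler_pM2l//.
  have : 0 <= I N :> R by rewrite invr_ge0.
  lra.
have /gap : (1 <= s <= N)%N by lia.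
have /gap : (1 <= N - s <= N)%N by lia.
lra.
Qed.

Lemma Ent_le_double_voter_time N s : (0 < s < N)%N ->
  N%:R ^+ 2 * Ent (s%:R / N%:R) <= 2 * voter_time N s.
Proof.
move=> sN; rewrite expr2 -mulrA Ent_nat// /voter_time [2 * (_ * _)]mulrCA ler_wpM2l//.
rewrite [2 * _]mulrDr ![2 * (_ * _)]mulrCA.
rewrite lerD// ler_wpM2l//; apply: ln_le_harmonic_gap; lia.
Qed.

End Harmonic.

(** * One step of the dictator chain *)

Section OneStep.
Variable N : nat.
Implicit Types (x : config N) (v u : 'I_N).

Definition copy x v u : config N := [ffun i => if i == v then x u else x i].

Lemma ones_le x : (ones x <= N)%N.
Proof. by rewrite /ones -[leqRHS](card_ord N) max_card. Qed.

Lemma onesC x : #|[set i | ~~ x i]%SET| = (N - ones x)%N.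
Proof.
have -> : [set i | ~~ x i]%SET = (~: [set i | x i])%SET.
  by apply/setP => i; rewrite !inE.
by rewrite cardsCs finset.setCK card_ord.
Qed.

Lemma is_constantE x : (0 < N)%N ->
  is_constant x <-> (ones x == 0%N) || (ones x == N).
Proof.
move=> N0; split=> [[[] xb]|].
- apply/orP; right; rewrite /ones (_ : [set i | x i]%SET = [set: _]%SET) ?cardsT
    ?card_ord//.
  by apply/setP => i; rewrite !inE xb.
- apply/orP; left; rewrite /ones (_ : [set i | x i]%SET = finset.set0) ?cards0//.
  by apply/setP => i; rewrite !inE xb.
case/orP=> [|/eqP xN].
  rewrite cards_eq0 => /eqP/setP x0; exists false => i.
  by have := x0 i; rewrite !inE.
exists true => i.
have /eqP/setP/(_ i) : [set i | ~~ x i]%SET == finset.set0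
  by rewrite -cards_eq0 onesC xN subnn.
by rewrite !inE => /negbFE.
Qed.

Lemma ones_copy x v u :
  ones (copy x v u) = if ~~ x v && x u then (ones x).+1
    else if x v && ~~ x u then (ones x).-1 else ones x.
Proof.
have split_v y : ones y = (y v + #|[set i | y i]%SET :\ v|)%N.
  by rewrite /ones (cardsD1 v) inE.
have -> : ones (copy x v u) = (x u + #|[set i | x i]%SET :\ v|)%N.
  rewrite split_v ffunE eqxx; congr (_ + #|pred_of_set _|)%N.
  by apply/setP => i; rewrite !inE ffunE; case: eqP.
by rewrite (split_v x); case: (x v); case: (x u).
Qed.

Variable R : realType.

(** A step raises the number of ones by pairing a zero [v] with a one [u], and
    lowers it by pairing a one with a zero; there are [ones x * (N - ones x)]
    pairs of either kind. *)
Lemma sum_copy (g : nat -> R) x : let k := ones x in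
  \sum_v \sum_u g (ones (copy x v u)) = N%:R ^+ 2 * g k +
    ((k * (N - k))%:R * (g k.+1 - g k) + (k * (N - k))%:R * (g k.-1 - g k)).
Proof.
move=> k.
have gE v u : g (ones (copy x v u)) = g k +
    ((~~ x v)%:R * (x u)%:R * (g k.+1 - g k) +
     (x v)%:R * (~~ x u)%:R * (g k.-1 - g k)).
  by rewrite ones_copy -/k; case: (x v); case: (x u) => /=; ring.
have sum1 : \sum_u (x u)%:R = k%:R :> R.
  rewrite /k /ones -sum1_card natr_sum [RHS]big_mkcond.
  by apply: eq_bigr => u _; rewrite inE; case: (x u).
have sum0 : \sum_u (~~ x u)%:R = (N - k)%:R :> R.
  rewrite /k -onesC -sum1_card natr_sum [RHS]big_mkcond.
  by apply: eq_bigr => u _; rewrite inE; case: (x u).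
under eq_bigr => v _.
  under eq_bigr do rewrite gE.
  rewrite !big_split/= sumr_const card_ord -!mulr_suml -!mulr_sumr sum1 sum0.
  over.
rewrite !big_split/= sumr_const card_ord -!mulr_suml sum1 sum0.
rewrite -mulrnA -mulr_natr !natrM.
ring.
Qed.

(** In expectation a step decreases [voter_time] by one until consensus: this
    makes [voter_time] the mean number of steps. *)
Lemma voter_time_drift x : (0 < N)%N ->
  \sum_v \sum_u N%:R ^- 2 * voter_time N (ones (copy x v u)) =
  voter_time N (ones x) - (0 < ones x < N)%N%:R :> R.
Proof.
move=> N0; have N2 : N%:R ^+ 2 != 0 :> R by rewrite expf_neq0// pnatr_eq0 -lt0n.
under eq_bigr do rewrite -mulr_sumr.
rewrite -mulr_sumr sum_copy mulrDr mulKf//; congr (_ + _).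
have [k_in|k_out] := boolP (0 < ones x < N)%N.
  by rewrite voter_time_poisson// mulrN mulVf.
have -> : (ones x * (N - ones x) = 0)%N.
  apply/eqP; rewrite muln_eq0 subn_eq0; have := ones_le x; lia.
by rewrite !mul0r addr0 mulr0 oppr0.
Qed.

End OneStep.

(** * Variables with finitely many values *)

Section FiniteValued.
Context {R : realType} {d : measure_display} {Om : measurableType d}.
Variable P : probability Om R.

Definition measurable_atoms (I : finType) (Z : Om -> I) :=
  forall i, measurable [set w | Z w = i].

Lemma measurable_atoms_preimage (I : finType) (Z : Om -> I) (B : set I) :
  measurable_atoms Z -> measurable [set w | B (Z w)].
Proof.
move=> mZ.
have -> : [set w | B (Z w)] = \bigcup_(i in B) [set w | Z w = i].
  by apply/seteqP; split => w /=; [exists (Z w)|move=> [i Bi /= ->]].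
by apply: fin_bigcup_measurable => [|i _]; [exact: finite_finset|exact: mZ].
Qed.

Lemma measurable_atoms_comp (I K : finType) (Z : Om -> I) (g : I -> K) :
  measurable_atoms Z -> measurable_atoms (g \o Z).
Proof.
by move=> mZ k; exact: (measurable_atoms_preimage [set i | g i = k] mZ).
Qed.

Lemma measurable_atoms_pair (I K : finType) (Y : Om -> I) (Z : Om -> K) :
  measurable_atoms Y -> measurable_atoms Z ->
  measurable_atoms (fun w => (Y w, Z w)).
Proof.
move=> mY mZ [i k].
rewrite (_ : [set _ | _] = [set w | Y w = i] `&` [set w | Z w = k]).
  exact: measurableI.
by apply/seteqP; split => w /= [-> ->].
Qed.

Lemma measurable_atoms_ffun (I K : finType) (Y : I -> Om -> K) :
  (forall i, measurable_atoms (Y i)) ->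
  measurable_atoms (fun w => [ffun i => Y i w]).
Proof.
move=> mY f.
rewrite (_ : [set _ | _] = \bigcap_(i in setT) [set w | Y i w = f i]).
  by apply: fin_bigcap_measurable => [|i _]; [exact: finite_finset|exact: mY].
apply/seteqP; split => w /=; first by move=> <- i _ /=; rewrite ffunE.
by move=> Yf; apply/ffunP => i; rewrite ffunE; exact: Yf.
Qed.

Local Notation pr E := (fine (P E)).

Lemma pr_partition (I : finType) (Z : Om -> I) (E : set Om) :
  measurable E -> measurable_atoms Z ->
  pr E = \sum_i pr (E `&` [set w | Z w = i]).
Proof.
move=> mE mZ.
have mEZ i : measurable (E `&` [set w | Z w = i]) by exact: measurableI.
rewrite sum_fine; last by move=> i _; exact: fin_num_measure.
congr fine.
rewrite fsbig_seq ?index_enum_uniq// -measure_fin_bigcup//.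
- congr (P _); apply/seteqP; split => w.
    by move=> Ew; exists (Z w) => //=; rewrite mem_index_enum.
  by move=> [i _ []].
- exact: trivIset_preimage1_in.
Qed.

(** The law of the unconscious statistician, restricted to the event [E]. *)
Lemma sum_pr_comp (I K : finType) (Z : Om -> I) (g : I -> K) (F : K -> R)
    (E : set Om) : measurable E -> measurable_atoms Z ->
  \sum_k pr (E `&` [set w | g (Z w) = k]) * F k =
  \sum_i pr (E `&` [set w | Z w = i]) * F (g i).
Proof.
move=> mE mZ.
have mgZ k : measurable (E `&` [set w | g (Z w) = k]).
  by apply: measurableI => //; exact: measurable_atoms_comp.
under eq_bigr => k _ do rewrite (pr_partition (mgZ k) mZ) mulr_suml.
rewrite exchange_big/=; apply: eq_bigr => i _.
rewrite (bigD1 (g i))//= big1 ?addr0 => [|k /eqP ki].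
  congr (fine (P _) * _); apply/seteqP; split => w /= [].
    by move=> [].
  by move=> ? ->.
rewrite (_ : _ `&` _ = set0) ?measure0 ?mul0r//.
by apply/seteqP; split => w //= -[[_ gk] Zi]; apply: ki; rewrite -gk Zi.
Qed.

End FiniteValued.

(** * The chain and its mean absorption time *)

Section Chain.
Context {R : realType} {r N : nat} {j : 'I_r} {d : measure_display}
  {Om : measurableType d} {P : probability Om R} {X : nat -> Om -> config N}
  {V : nat -> Om -> 'I_N} {J : nat -> 'I_r -> Om -> 'I_N}.
Hypothesis ch : is_chain (dictator j) P X V J.
Hypothesis N_gt0 : (0 < N)%N.

Local Notation pr E := (fine (P E)).
Local Notation draws := ('I_N * {ffun 'I_r -> 'I_N})%type.

Definition draw t w : draws := (V t w, [ffun k => J t k w]).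

Definition history m w : config N * {ffun 'I_m -> draws} :=
  (X 0%N w, [ffun t : 'I_m => draw t w]).

Lemma chain_copy t w :
  X t.+1 w = copy (X t w) (draw t w).1 ((draw t w).2 j).
Proof.
rewrite (chain_step ch) /update /copy /dictator /= !ffunE.
by apply/ffunP => i; rewrite !ffunE.
Qed.

Lemma measurable_draw t : measurable_atoms (draw t).
Proof.
apply: measurable_atoms_pair; first exact: (chain_meas_V ch).
by apply: measurable_atoms_ffun => k; exact: (chain_meas_J ch).
Qed.

Lemma measurable_state t : measurable_atoms (X t).
Proof.
elim: t => [|t IH]; first exact: (chain_meas_init ch).
rewrite (_ : X t.+1 = (fun z : config N * draws => copy z.1 z.2.1 (z.2.2 j)) \o
    (fun w => (X t w, draw t w))).
  apply: measurable_atoms_comp.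
  by apply: measurable_atoms_pair IH (@measurable_draw t).
by apply/funext => w; rewrite chain_copy.
Qed.

Lemma measurable_history m : measurable_atoms (history m).
Proof.
apply: measurable_atoms_pair; first exact: (chain_meas_init ch).
by apply: measurable_atoms_ffun => t; exact: measurable_draw.
Qed.

Lemma state_history m w w' : history m w = history m w' -> X m w = X m w'.
Proof.
move=> [X0 /ffunP dd].
have {dd}dd t : (t < m)%N -> draw t w = draw t w'.
  by move=> tm; have := dd (Ordinal tm); rewrite !ffunE.
elim: m dd => [//|m IH] dd; rewrite !chain_copy dd// IH// => t tm.
by apply: dd; exact: ltnW.
Qed.

(** The probability of any given value of [draw t]. *)
Definition draw_weight : R := N%:R^-1 * N%:R^-1 ^+ r.

Lemma pr_history m (h : config N * {ffun 'I_m -> draws}) :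
  pr [set w | history m w = h] = pr [set w | X 0%N w = h.1] * draw_weight ^+ m.
Proof.
case: h => x z /=.
have := chain_indep ch x (fun t => (z t).1) (fun t k => (z t).2 k).
under eq_bigr => t _.
  rewrite (chain_unif_V ch).
  under eq_bigr do rewrite (chain_unif_J ch).
  rewrite prodEFin prodr_const card_ord -EFinM -/draw_weight.
  over.
rewrite prodEFin prodr_const card_ord => indep.
rewrite (_ : [set w | history m w = (x, z)] = [set w | X 0%N w = x /\
    forall t : 'I_m, V t w = (z t).1 /\ forall k, J t k w = (z t).2 k]).
  by rewrite indep fineM// ?fin_num_measure//; exact: (chain_meas_init ch).
apply/seteqP; split => w /=.
  by move=> [<- <-]; split=> // t; rewrite !ffunE /=; split=> // k; rewrite ffunE.
move=> [X0 dw]; rewrite /history X0; congr (_, _); apply/ffunP => t.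
rewrite ffunE /draw; have [-> Jk] := dw t.
by rewrite [RHS]surjective_pairing; congr (_, _); apply/ffunP => k;
  rewrite ffunE Jk.
Qed.

Lemma pr_history_draw m h z :
  pr ([set w | history m w = h] `&` [set w | draw m w = z]) =
  pr [set w | history m w = h] * draw_weight.
Proof.
case: h => x f.
(* The joint event is an atom of the history at time [m.+1]: [f] extended by [z]. *)
pose f' : {ffun 'I_m.+1 -> draws} :=
  [ffun t : 'I_m.+1 => if unlift ord_max t is Some t' then f t' else z].
rewrite (_ : _ `&` _ = [set w | history m.+1 w = (x, f')]).
  by rewrite !pr_history exprSr mulrA.
rewrite {}/f'; apply/seteqP; split => w /=.
  move=> [[<- <-] <-]; rewrite /history; congr (_, _); apply/ffunP => t.
  rewrite !ffunE.
  by case: (unliftP ord_max t) => [t1|] ->; rewrite ?ffunE ?lift_max.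
move=> [<- /ffunP ff]; split.
  rewrite /history; congr (_, _); apply/ffunP => t; rewrite ffunE.
  by have := ff (lift ord_max t); rewrite !ffunE liftK lift_max.
by have := ff ord_max; rewrite !ffunE unlift_none.
Qed.

(** An event determined by the history contains or misses each of its atoms, and
    on atoms the independence of the next draw is [pr_history_draw]. *)
Lemma pr_past_draw m (E : set Om) z : measurable E ->
  (forall w w', history m w = history m w' -> E w -> E w') ->
  pr (E `&` [set w | draw m w = z]) = pr E * draw_weight.
Proof.
move=> mE pastE.
have mD : measurable [set w | draw m w = z] by exact: measurable_draw.
rewrite (pr_partition P (measurableI _ _ mE mD) (@measurable_history m)).
rewrite (pr_partition P mE (@measurable_history m)) mulr_suml.
apply: eq_bigr => h _.
have [[w0 [Ew0 hw0]]|noE] := pselect (exists w, E w /\ history m w = h).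
  have EhE : E `&` [set w | history m w = h] = [set w | history m w = h].
    by apply/setIidr => w /= hw; apply: pastE Ew0; rewrite hw.
  by rewrite setIAC EhE pr_history_draw.
rewrite setIAC (_ : E `&` [set w | history m w = h] = set0).
  by rewrite set0I measure0 mul0r.
by apply/seteqP; split => w // [Ew hw]; apply: noE; exists w.
Qed.

(** Only one of the [r] sources matters: the others sum out. *)
Lemma sum_draw (g : 'I_N -> 'I_N -> R) :
  \sum_(z : draws) draw_weight * g z.1 (z.2 j) =
  \sum_v \sum_u N%:R ^- 2 * g v u.
Proof.
rewrite -(pair_bigA _ (fun v (u : {ffun 'I_r -> 'I_N}) =>
  draw_weight * g v (u j)))/=.
apply: eq_bigr => v _.
(* A product over the coordinates of [u], so that the sum over [u] factors. *)
have prodE (u : {ffun 'I_r -> 'I_N}) : draw_weight * g v (u j) = N%:R^-1 *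
    \prod_k (N%:R^-1 * (if k == j then g v (u k) else 1)).
  rewrite big_split/= prodr_const card_ord /draw_weight -mulrA.
  by rewrite (bigD1 j)//= eqxx big1 ?mulr1// => k /negPf ->.
under eq_bigr do rewrite prodE.
rewrite -mulr_sumr -(bigA_distr_bigA (fun k u =>
  N%:R^-1 * (if k == j then g v u else 1))).
rewrite (bigD1 j)//= eqxx [X in _ * (_ * X)]big1 ?mulr1 => [|k /negPf ->].
  by rewrite mulr_sumr; apply: eq_bigr => u _; rewrite mulrA -invfM -expr2.
by rewrite sumr_const card_ord mulr1 -(mulr_natr N%:R^-1) mulVf// pnatr_eq0 -lt0n.
Qed.

Variable s : nat.
Let A : set Om := [set w | ones (X 0%N w) = s].

Let unsettled m : set Om := [set w | (0 < ones (X m w) < N)%N].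

Let measurable_A : measurable A.
Proof.
exact: (measurable_atoms_preimage [set x | ones x = s] (@measurable_state 0)).
Qed.

Let measurable_unsettled m : measurable (unsettled m).
Proof.
exact: (measurable_atoms_preimage [set x | (0 < ones x < N)%N]
  (@measurable_state m)).
Qed.

(** The expectation of [F (X m)] on [S_0 = s], not divided by the probability of
    that event. *)
Let mean m (F : config N -> R) := \sum_x pr (A `&` [set w | X m w = x]) * F x.

Lemma mean_step m (F : config N -> R) :
  mean m.+1 F = mean m (fun x => \sum_v \sum_u N%:R ^- 2 * F (copy x v u)).
Proof.
have mXD : measurable_atoms (fun w => (X m w, draw m w)).
  by apply: measurable_atoms_pair; [exact: measurable_state|exact: measurable_draw].
pose g (z : config N * draws) := copy z.1 z.2.1 (z.2.2 j).
have -> : mean m.+1 F = \sum_x pr (A `&` [set w | g (X m w, draw m w) = x]) * F x.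
  apply: eq_bigr => x _; congr (fine (P (_ `&` _)) * _).
  by apply/seteqP; split => w /=; rewrite chain_copy.
rewrite (sum_pr_comp P g F measurable_A mXD) /g.
transitivity (\sum_x \sum_z pr (A `&` [set w | (X m w, draw m w) = (x, z)]) *
    F (copy x z.1 (z.2 j))).
  by rewrite pair_bigA; apply: eq_bigr => -[x z] _.
apply: eq_bigr => x _.
rewrite -sum_draw mulr_sumr; apply: eq_bigr => z _; rewrite mulrA; congr (_ * _).
rewrite -(@pr_past_draw m _ z).
- congr (fine (P _)); apply/seteqP; split => w /=.
    by move=> [? [? ?]].
  by move=> [[? ->] ->].
- by apply: measurableI => //; exact: measurable_state.
- move=> w w' hh [Aw Xw]; split; last by rewrite /= -(state_history hh).
  by case: hh => X0 _; rewrite /A /= -X0.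
Qed.

Lemma mean_unsettled m :
  mean m (fun x => (0 < ones x < N)%N%:R) = pr (A `&` unsettled m).
Proof.
rewrite (pr_partition P (measurableI _ _ measurable_A (@measurable_unsettled m))
  (@measurable_state m)).
apply: eq_bigr => x _; case: (boolP (0 < ones x < N)%N) => xN; rewrite ?mulr1 ?mulr0.
  congr (fine (P _)); apply/seteqP; split => w /=; last by move=> [[]].
  by move=> [Aw Xw]; split=> //; split=> //; rewrite /unsettled /= Xw.
rewrite (_ : _ `&` _ = set0) ?measure0//; apply/seteqP; split => w //= -[[_ uw] Xw].
by move: uw xN; rewrite /unsettled /= Xw => ->.
Qed.

Let value (x : config N) : R := voter_time N (ones x).

Lemma mean_value_step m : mean m.+1 value = mean m value - pr (A `&` unsettled m).
Proof.
rewrite mean_step -mean_unsettled -sumrB; apply: eq_bigr => x _.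
by rewrite voter_time_drift// mulrBr.
Qed.

Lemma mean_value0 : mean 0 value = pr A * voter_time N s.
Proof.
rewrite (pr_partition P measurable_A (@measurable_state 0)) mulr_suml.
apply: eq_bigr => x _; have [<-//|/eqP xs] := eqVneq (ones x) s.
rewrite (_ : _ `&` _ = set0) ?measure0 ?mul0r//.
by apply/seteqP; split => w //= -[As Xw]; apply: xs; rewrite -Xw.
Qed.

Let bound : R := \sum_(k < N.+1) `|voter_time N k|.

(** [voter_time] vanishes at consensus. *)
Lemma norm_mean_value m : `|mean m value| <= bound * pr (A `&` unsettled m).
Proof.
rewrite -mean_unsettled mulr_sumr (le_trans (ler_norm_sum _ _ _))//.
apply: ler_sum => x _; rewrite normrM ger0_norm ?fine_ge0// mulrCA ler_wpM2l ?fine_ge0//.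
case: (boolP (0 < ones x < N)%N) => [_|xN].
  have xN : (ones x < N.+1)%N by rewrite ltnS ones_le.
  by rewrite mulr1 /bound (bigD1 (Ordinal xN))//= lerDl sumr_ge0.
rewrite mulr0 /value; have [->|->] : ones x = 0%N \/ ones x = N.
  by have := ones_le x; lia.
  by rewrite voter_time0 normr0.
by rewrite voter_timeN normr0.
Qed.

Lemma series_unsettled n :
  series (fun m => pr (A `&` unsettled m)) n = mean 0 value - mean n value.
Proof.
elim: n => [|n IH]; first by rewrite /series /= big_geq// subrr.
by rewrite seriesSr IH mean_value_step; ring.
Qed.


(** The partial sums are [mean 0 value - mean n value], where the last term is
    bounded, so that the series converges; its terms then tend to [0], and they
    dominate [mean n value]. *)
Lemma cvg_series_unsettled :
  series (fun m => pr (A `&` unsettled m)) @ \oo --> pr A * voter_time N s.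
Proof.
set b := fun m => _.
have mU m : measurable (A `&` unsettled m) by exact: measurableI.
have b0 m : 0 <= b m by exact: fine_ge0.
have b1 m : b m <= 1.
  by rewrite -lee_fin fineK ?fin_num_measure// probability_le1.
have bound_ge0 : 0 <= bound by exact: sumr_ge0.
have b_cvg0 : b @ \oo --> 0.
  apply: cvg_series_cvg_0; apply: nondecreasing_is_cvgn.
    by apply: nondecreasing_series => k _ _; exact: b0.
  exists (mean 0 value + bound) => _ [n _ <-]; rewrite series_unsettled lerD2l.
  rewrite lerNl (le_trans _ (lerNnormlW (lexx _)))// lerN2.
  by rewrite (le_trans (norm_mean_value _))// ler_piMr// b1.
have mean_cvg0 : mean ^~ value @ \oo --> 0.
  apply: norm_cvg0; apply: (@squeeze_cvgr _ _ _ _ (fun=> 0) (fun m => bound * b m)).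
  - by apply: nearW => m; rewrite normr_ge0 norm_mean_value.
  - exact: cvg_cst.
  - by rewrite -[X in _ --> X](mulr0 bound); apply: cvgM b_cvg0; exact: cvg_cst.
rewrite -mean_value0 -[X in _ --> X]subr0.
rewrite (_ : series b = fun n => mean 0 value - mean n value).
  by apply: cvgB => //; exact: cvg_cst.
by apply/funext => n; rewrite series_unsettled.
Qed.

Lemma constant_absorbing m t w :
  is_constant (X m w) -> is_constant (X (m + t) w).
Proof.
move=> mC; elim: t => [|t [c Xc]]; first by rewrite addn0.
by exists c => i; rewrite addnS chain_copy ffunE; case: eqP.
Qed.

Lemma unsettledE m w : unsettled m w <-> ~ is_constant (X m w).
Proof.
rewrite is_constantE// /unsettled /=; have := ones_le (X m w).
by move: (ones _) => k kN; split=> [|/negP]; lia.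
Qed.

(** Absorption makes the times before [T] exactly those at which the chain is not
    constant; when [T] is infinite both sides are. *)
Lemma absorption_timeE w :
  absorption_time R X w = (\sum_(t <oo) (\1_(unsettled t) w)%:E)%E.
Proof.
have before t : ~ is_constant (X t w) -> \1_(unsettled t) w = 1 :> R.
  by move=> /unsettledE uw; rewrite indicE mem_set.
have after t : is_constant (X t w) -> \1_(unsettled t) w = 0 :> R.
  by move=> Xc; rewrite indicE memNset// => /unsettledE.
have [[t0 Xt0]|never] := pselect (exists t, is_constant (X t w)).
  have exb : exists t, `[< is_constant (X t w) >] by exists t0; exact/asboolP.
  case: (ex_minnP exb) => T /asboolP XT minT.
  rewrite (nneseries_split 0 T) => [|k _]; last by rewrite lee_fin indicE.
  rewrite eseries0 ?adde0 => [|t Tt _]; last first.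
    by rewrite after// -(subnKC Tt); exact: constant_absorbing.
  rewrite add0n (eq_big_nat _ _ (F2 := fun=> 1%:E)) => [|t /andP[_ tT]]; last first.
    by rewrite before// => /asboolP/minT; rewrite leqNgt tT.
  rewrite sumEFin sumr_const_nat subn0.
  apply/eqP; rewrite eq_le; apply/andP; split.
    by apply: ge_ereal_inf; exists (T%:R)%:E => //; exists T.
  apply: le_ereal_inf_tmp => _ [t /= Xt <-].
  by rewrite lee_fin ler_nat minT//; exact/asboolP.
rewrite /absorption_time (_ : [set t | _] = set0); last first.
  by apply/seteqP; split => t //= Xt; apply: never; exists t.
rewrite image_set0 ereal_inf0; apply/esym/eq_infty => x.
have [n xn] : exists n, x <= n%:R.
  by exists (Num.bound `|x|); rewrite (le_trans (ler_norm _))// ltW// archi_boundP.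
apply: le_trans (nneseries_lim_ge (m := 0) n _); last first.
  by move=> k _ _; rewrite lee_fin indicE.
rewrite (eq_big_nat _ _ (F2 := fun=> 1%:E)) => [|t _].
  by rewrite sumEFin sumr_const_nat subn0 lee_fin.
by rewrite before// => Xt; apply: never; exists t.
Qed.

Lemma integral_absorption_time :
  (\int[P]_(w in A) absorption_time R X w = P A * (voter_time N s)%:E)%E.
Proof.
under eq_integral do rewrite absorption_timeE.
rewrite integral_nneseries//; last first.
  by move=> t; apply/measurable_realfun.measurable_EFinP;
    exact: measurable_realfun.measurable_indic.
rewrite (eq_eseriesr (g := fun t => (pr (A `&` unsettled t))%:E)) => [|t _]; last first.
  by rewrite integral_indic// setIC fineK// fin_num_measure//; exact: measurableI.
rewrite -[P A]fineK ?fin_num_measure// -EFinM.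
apply/cvg_lim => //.
rewrite (_ : (fun n => _) = EFin \o series (fun m => pr (A `&` unsettled m))).
  by apply: cvg_EFin; [exact: nearW|exact: cvg_series_unsettled].
by apply/funext => n /=; rewrite sumEFin.
Qed.

End Chain.

Lemma mean_absorption_timeE (R : realType) (r N : nat) (j : 'I_r) (s : nat)
    (e : \bar R) : (0 < N)%N ->
  mean_absorption_time N (dictator j) s e -> e = (voter_time N s)%:E.
Proof.
move=> N_gt0 [d [Om [P [X [V [J [ch A_gt0 ->]]]]]]].
rewrite (integral_absorption_time ch N_gt0).
have mA : measurable [set w | ones (X 0%N w) = s].
  exact: (measurable_atoms_preimage [set x | ones x = s] (measurable_state ch 0)).
by rewrite muleAC divee ?mul1e ?fin_num_measure// gt_eqF.
Qed.

(** * Entropy estimates and asymptotics *)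

Section Asymptotics.
Context {R : realType}.
Implicit Types (p : R) (N s : nat).
Local Notation L n := (ln (n%:R : R)).

(** Both sides come from [1 - 1 / x <= ln x <= x - 1], at [x = p] and
    [x = 1 - p]. *)
Lemma Ent_bounds p : 0 < p < 1 -> p * (1 - p) <= Ent p <= 1.
Proof.
move=> /andP[p0 p1]; have q0 : 0 < 1 - p by rewrite subr_gt0.
have lnB (x : R) : 0 < x -> 1 - x^-1 <= ln x <= x - 1.
  move=> x0; apply/andP; split; last first.
    by rewrite -[X in ln X](subrKC 1) le_ln1Dx// ltrBrDl subrr.
  rewrite -[X in ln X]invrK lnV ?posrE ?invr_gt0// lerNr opprB.
  by rewrite -[X in ln X](subrKC 1) le_ln1Dx// ltrBrDl subrr invr_gt0.
have mul_lnB (x : R) : 0 < x -> x * (1 - x) <= - x * ln x <= 1 - x.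
  move=> x0; have /andP[lo hi] := lnB _ x0; apply/andP; split.
    by rewrite mulNr -mulrN ler_pM2l// lerNr opprB.
  rewrite -[leRHS]opprB mulNr lerN2 -[leLHS]opprB opprB.
  apply: le_trans (ler_wpM2l (ltW x0) lo).
  by rewrite mulrBr mulr1 divff ?gt_eqF.
have /andP[lo1 hi1] := mul_lnB _ p0; have /andP[lo2 hi2] := mul_lnB _ q0.
have : 0 <= (1 - p) * (1 - (1 - p)) by rewrite subKr mulr_ge0// ltW.
rewrite /Ent; move: (ln p) (ln (1 - p)) lo1 hi1 lo2 hi2 => a b lo1 hi1 lo2 hi2 pq.
by apply/andP; split; lra.
Qed.

Lemma continuous_Ent p : 0 < p < 1 -> {for p, continuous (@Ent R)}.
Proof.
move=> /andP[p0 p1]; rewrite /Ent.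
have cB : 1 - x @[x --> p] --> 1 - p by apply: cvgB; [exact: cvg_cst|exact: cvg_id].
apply: cvgB; apply: cvgM => //.
- by apply: cvgN; exact: cvg_id.
- exact: continuous_ln.
- by apply: (cvg_comp _ _ cB); apply: continuous_ln; rewrite subr_gt0.
Qed.

Lemma voter_time_Ent_dist N s : (0 < s < N)%N ->
  `|voter_time N s / N%:R ^+ 2 - Ent (s%:R / N%:R)| <= 3 / N%:R :> R.
Proof.
move=> sN; have N0 : 0 < N%:R :> R by rewrite ltr0n; lia.
have up := @voter_time_le_Ent R _ _ sN; have lo := @Ent_sub_le_voter_time R _ _ sN.
rewrite -(ler_pM2l (exprn_gt0 2 N0)) -[X in X * `|_|]gtr0_norm ?exprn_gt0// -normrM.
rewrite mulrBr mulrCA mulfV ?expf_neq0 ?gt_eqF// mulr1.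
rewrite (_ : _ * (3 / _) = 3 * N%:R); last by field; rewrite gt_eqF.
by rewrite ler_norml; apply/andP; split; lra.
Qed.

Lemma natr_inv_le eps : 0 < eps -> \forall N \near \oo, N%:R^-1 <= eps :> R.
Proof.
move=> e0; near=> N; rewrite invf_ple ?posrE//; last first.
  by rewrite ltr0n; near: N; exact: nbhs_infty_gt.
by near: N; exact: nbhs_infty_ger.
Unshelve. all: by end_near. Qed.

Lemma cvg_natr_inv : N%:R^-1 @[N --> \oo] --> (0 : R).
Proof.
apply/cvgr0Pnorm_le => eps /natr_inv_le; apply: filterS => N.
by rewrite ger0_norm.
Qed.

Lemma truncn_mul_near p : 0 < p < 1 ->
  \forall N \near \oo, (0 < Num.truncn (p * N%:R) < N)%N.
Proof.
move=> /andP[p0 p1]; near=> N.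
have N_gt0 : (0 < N)%N by near: N; exact: nbhs_infty_gt.
have N0 : 0 < N%:R :> R by rewrite ltr0n.
have pN0 : 0 <= p * N%:R by rewrite mulr_ge0// ltW.
rewrite truncn_gt0 truncn_lt_nat// gtr_pMl// p1 andbT.
by rewrite mulrC -ler_pdivrMr// div1r; near: N; exact: nbhs_infty_ger.
Unshelve. all: by end_near. Qed.

Lemma cvg_truncn_mul p : 0 <= p ->
  (Num.truncn (p * N%:R))%:R / N%:R @[N --> \oo] --> p.
Proof.
move=> p0; apply/cvgrPdist_le => eps e0; near=> N.
have N0 : 0 < N%:R :> R by rewrite ltr0n; near: N; exact: nbhs_infty_gt.
have /truncn_itv/andP[lo hi] : 0 <= p * N%:R by rewrite mulr_ge0.
have -> : p - (Num.truncn (p * N%:R))%:R / N%:R =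
    (p * N%:R - (Num.truncn (p * N%:R))%:R) / N%:R.
  by rewrite mulrBl mulfK ?gt_eqF.
rewrite ger0_norm ?divr_ge0 ?subr_ge0// (@le_trans _ _ (N%:R^-1))//.
  by rewrite ler_piMl// lerBlDl natr1 ltW.
by near: N; exact: natr_inv_le.
Unshelve. all: by end_near. Qed.

Lemma cvg_voter_time p : 0 < p < 1 ->
  voter_time N (Num.truncn (p * N%:R)) / N%:R ^+ 2 @[N --> \oo] --> Ent p.
Proof.
move=> p01; have p0 : 0 <= p by case/andP: p01 => /ltW.
pose q N : R := (Num.truncn (p * N%:R))%:R / N%:R.
have cE : Ent (q N) @[N --> \oo] --> Ent p.
  exact: cvg_comp (cvg_truncn_mul p0) (continuous_Ent p01).
have c0 : voter_time N (Num.truncn (p * N%:R)) / N%:R ^+ 2 - Ent (q N)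
    @[N --> \oo] --> (0 : R).
  apply: norm_cvg0; apply: (@squeeze_cvgr _ _ _ _ (fun=> 0) (fun N => 3 / N%:R)).
  - apply: filterS (truncn_mul_near p01) => N sN.
    by rewrite normr_ge0 voter_time_Ent_dist.
  - exact: cvg_cst.
  - by rewrite -[X in _ --> X](mulr0 3); apply: cvgM; [exact: cvg_cst|exact: cvg_natr_inv].
have cD := cvgD c0 cE; rewrite add0r in cD.
rewrite (_ : (fun N => _) = fun N => (voter_time N (Num.truncn (p * N%:R)) /
  N%:R ^+ 2 - Ent (q N)) + Ent (q N)); first exact: cD.
by apply/funext => N; rewrite subrK.
Qed.

Lemma ln2_ge : 2^-1 <= ln 2 :> R.
Proof. by have /andP[+ _] := @ln_natS_bounds R 1 isT; rewrite ln1 subr0. Qed.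

(** [H_(N - 1)] lies between [H_N - 1] and [H_N]; the additive constants are
    absorbed using [ln N >= ln 2 >= 1 / 2]. *)
Lemma harmonic_ln_bounds N : (2 <= N)%N ->
  2^-1 * L N <= harmonic_number R (N - 1) <= 3 * L N.
Proof.
case: N => [//|N] N2; rewrite subn1 /=.
have H1 : harmonic_number R 1 = 1 by rewrite /harmonic_number big_nat1 invr1.
have lo := @ln_le_harmonic_gap R 1 N.+1 isT.
have /andP[_ hi] := @harmonic_gap_bounds R 1 N.+1 isT.
have l2 : ln 2 <= L N.+1 by rewrite ler_ln ?posrE// ler_nat.
have := ln2_ge; have : 0 < N.+1%:R^-1 :> R by rewrite invr_gt0.
have : N.+1%:R^-1 <= 2^-1 :> R by rewrite lef_pV2 ?posrE// ler_nat.
move: lo hi l2; rewrite H1 harmonic_numberS ln1.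
move: (N.+1%:R^-1) (L N.+1) (harmonic_number _ _) (ln 2) => a b c e ? ? ? ? ? ?.
by apply/andP; split; lra.
Qed.

(** The term of the majority contributes at most [N * s], by
    [ln (1 + x) <= x] at [x = s / (N - s)]. The hypothesis gives
    [ln (N / s) >= ln 4 >= 1], so this is absorbed by the term of the minority. *)
Lemma voter_time_small N s : (0 < s)%N -> 4 * s%:R <= N%:R :> R ->
  2^-1 * (N%:R * s%:R * ln (N%:R / s%:R : R)) <= voter_time N s
    <= 2 * (N%:R * s%:R * ln (N%:R / s%:R : R)).
Proof.
move=> s0 sN4; have s0' : 0 < s%:R :> R by rewrite ltr0n.
have sN : (0 < s < N)%N by move: sN4; rewrite -natrM ler_nat; lia.
have N0 : 0 < N%:R :> R by rewrite ltr0n; lia.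
have m0 : 0 < (N - s)%:R :> R by rewrite ltr0n; lia.
rewrite ln_div ?posrE//; set l := L N - L s.
have l1 : 1 <= l.
  rewrite /l -ln_div ?posrE// (@le_trans _ _ (ln (2 ^+ 2)))//.
    by rewrite lnXn//; move: ln2_ge; move: (ln 2) => a ?; lra.
  by rewrite ler_ln ?posrE ?divr_gt0 ?exprn_gt0// ler_pdivlMr// -natrX.
have m_ln : 0 <= (N - s)%:R * (L N - L (N - s)) <= s%:R.
  rewrite -ln_div ?posrE//.
  have NmE : N%:R / (N - s)%:R = 1 + s%:R / (N - s)%:R :> R.
    by rewrite -[X in X / _](@subrK _ s%:R) -natrB ?mulrDl ?divff ?gt_eqF//; lia.
  apply/andP; split.
    rewrite mulr_ge0// NmE ln_ge0// lerDl divr_ge0//.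
  rewrite mulrC -ler_pdivlMr// NmE le_ln1Dx// (lt_trans (ltrN10 _))// divr_gt0//.
have [m_lo m_hi] := andP m_ln.
have := @voter_time_le_Ent R _ _ sN; have := @Ent_le_double_voter_time R _ _ sN.
rewrite expr2 -!mulrA Ent_nat// -/l.
have sl : s%:R <= s%:R * l by rewrite ler_pMr.
set e := s%:R * l + _ => lo hi; apply/andP; split.
  rewrite ler_pdivrMl// (le_trans _ lo)//.
  by rewrite ler_pM2l// lerDl.
rewrite (le_trans hi)// mulrCA ler_pM2l// /e; lra.
Qed.

End Asymptotics.

Theorem corollary27 (R : realType) (r : nat) (j : 'I_r)
    (phi : nat -> nat -> \bar R)
    (phiE : forall N s : nat, (2 <= N)%N -> (1 <= s <= N - 1)%N ->
       mean_absorption_time N (dictator j) s (phi N s)) :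
  (* (a) *)
  [/\ (forall N s : nat, (2 <= N)%N -> (1 <= s <= N - 1)%N ->
        (`| phi N s / (N%:R ^+ 2)%:E - (Ent (s%:R / N%:R))%:E |
           <= (3 / N%:R : R)%:E)%E),
      (forall p : R, 0 < p < 1 ->
        (phi N (Num.truncn (p * N%:R)) / (N%:R ^+ 2)%:E)%E @[N --> \oo]
          --> (Ent p)%:E) &
      (forall eps : R, 0 < eps ->
        exists c C : R, 0 < c /\ 0 < C /\
          forall N s : nat, (2 <= N)%N -> (1 <= s <= N - 1)%N ->
            eps <= s%:R / N%:R <= 1 - eps ->
            ((c * N%:R ^+ 2)%:E <= phi N s <= (C * N%:R ^+ 2)%:E)%E)] /\
  (* (b) *)
  [/\ (forall N : nat, (2 <= N)%N ->
        phi N 1%N = (N%:R * harmonic_number R (N - 1))%:E),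
      (fun N : nat => N%:R * harmonic_number R (N - 1))
        =Theta_\oo (fun N : nat => N%:R * ln (N%:R : R)) &
      (forall N : nat, (2 <= N)%N ->
        phi N (N - 1)%N = (N%:R * harmonic_number R (N - 1))%:E)] /\
  (* (c) *)
  (exists c C : R, 0 < c /\ 0 < C /\
     forall s : nat -> nat,
       (\forall N \near \oo, (1 <= s N)%N) ->
       (fun N : nat => (s N)%:R : R) =o_\oo (fun N : nat => N%:R : R) ->
       \forall N \near \oo,
         ((c * (N%:R * (s N)%:R * ln (N%:R / (s N)%:R)))%:E <= phi N (s N) <=
          (C * (N%:R * (s N)%:R * ln (N%:R / (s N)%:R)))%:E)%E) /\
  (* (d) *)
  (forall N s : nat, (2 <= N)%N -> (1 <= s <= N - 1)%N ->
     ((6^-1 * N%:R ^+ 2 * Ent (s%:R / N%:R))%:E <= phi N s <=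
      (2 * N%:R ^+ 2 * Ent (s%:R / N%:R))%:E)%E).
Proof.
have phi_real N s : (2 <= N)%N -> (1 <= s <= N - 1)%N ->
    phi N s = (voter_time N s)%:E.
  by move=> N2 sN; apply: (mean_absorption_timeE _ (phiE _ _ N2 sN)); lia.
have phi_div N s : (2 <= N)%N -> (1 <= s <= N - 1)%N ->
    (phi N s / (N%:R ^+ 2)%:E)%E = (voter_time N s / N%:R ^+ 2)%:E.
  move=> N2 sN; rewrite phi_real// inver ifF// expf_eq0/= pnatr_eq0; lia.
have s_lt N s : (2 <= N)%N -> (1 <= s <= N - 1)%N -> (0 < s < N)%N
  by move=> *; lia.
have ratio01 N s : (0 < s < N)%N -> 0 < (s%:R / N%:R : R) < 1.
  move=> sN; have N0 : 0 < N%:R :> R by rewrite ltr0n; lia.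
  by rewrite ltr_pdivrMr// divr_gt0//= ?mul1r ?ltr_nat ?ltr0n; lia.
split; [split|split; [split|split]].
- move=> N s N2 sN; rewrite phi_div// lee_fin; exact/voter_time_Ent_dist/s_lt.
- move=> p p01; have phi_near : \forall N \near \oo,
      (voter_time N (Num.truncn (p * N%:R)) / N%:R ^+ 2)%:E =
      (phi N (Num.truncn (p * N%:R)) / (N%:R ^+ 2)%:E)%E :> \bar R.
    near=> N; rewrite phi_div//; first by near: N; exact: nbhs_infty_ge.
    have : (0 < Num.truncn (p * N%:R) < N)%N by near: N; exact: truncn_mul_near.
    lia.
  apply: cvg_trans (near_eq_cvg phi_near) _.
  by apply: cvg_EFin; [exact: nearW|exact: cvg_voter_time].
- move=> eps e0.
  (* [Ent p >= p * (1 - p) >= eps ^+ 2], and [Ent p <= 1]. *)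
  exists (2^-1 * eps ^+ 2), 1; split; [|split=> //].
    by rewrite mulr_gt0// exprn_gt0.
  move=> N s N2 sN /andP[lo hi]; have sN' := s_lt _ _ N2 sN.
  have /Ent_bounds/andP[Elo Ehi] := ratio01 _ _ sN'.
  rewrite phi_real// !lee_fin mul1r; apply/andP; split; last first.
    rewrite (le_trans (voter_time_le_Ent sN'))// ler_piMr// exprn_ge0//.
  rewrite -mulrA ler_pdivrMl//.
  rewrite (le_trans _ (Ent_le_double_voter_time sN'))// mulrC ler_wpM2l ?exprn_ge0//.
  rewrite (le_trans _ Elo)// expr2 ler_pM ?(ltW e0)//.
  by move: hi; move: (s%:R / N%:R) => p hi; lra.
- by move=> N N2; rewrite phi_real ?voter_time1//; lia.
- rewrite eqThetaE qualifE; apply/asboolP; exists (2^-1, 3).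
    by rewrite /= invr_gt0 !ltr0n.
  near=> N; have N2 : (2 <= N)%N by near: N; exact: nbhs_infty_ge.
  have /andP[lo hi] := @harmonic_ln_bounds R _ N2.
  have l0 : 0 <= ln (N%:R : R) by rewrite ln_ge0// ler1n; lia.
  have h0 : 0 <= harmonic_number R (N - 1).
    by rewrite (le_trans _ lo)// mulr_ge0// invr_ge0.
  by rewrite /= !ger0_norm ?mulr_ge0// ![_ * (N%:R * _)]mulrCA !ler_wpM2l.
- move=> N N2; rewrite phi_real//; last by lia.
  by rewrite voter_timeC ?voter_time1//; lia.
- exists 2^-1, 2; split; [by rewrite invr_gt0|split=> // s s1 so].
  have s4 : \forall N \near \oo, `|(s N)%:R : R| <= 4^-1 * `|N%:R : R|.
    by move/eqoP: so; apply; rewrite invr_gt0.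
  near=> N.
  have s_gt0 : (0 < s N)%N by near: N.
  have sN4 : 4 * (s N)%:R <= N%:R :> R.
    have : `|(s N)%:R : R| <= 4^-1 * `|N%:R : R| by near: N.
    by rewrite !ger0_norm//; lra.
  have sN4' : (4 * s N <= N)%N by move: sN4; rewrite -natrM ler_nat.
  by rewrite phi_real ?lee_fin; [exact: voter_time_small| lia | lia].
- move=> N s N2 sN; have sN' := s_lt _ _ N2 sN.
  have up := @voter_time_le_Ent R _ _ sN'; have lo := @Ent_le_double_voter_time R _ _ sN'.
  have /Ent_bounds/andP[Elo _] := ratio01 _ _ sN'.
  have E0 : 0 <= Ent (s%:R / N%:R : R).
    have /andP[? /ltW ?] := ratio01 _ _ sN'.
    by rewrite (le_trans _ Elo)// mulr_ge0 ?subr_ge0// ltW.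
  have NE0 : 0 <= N%:R ^+ 2 * Ent (s%:R / N%:R : R) by rewrite mulr_ge0// exprn_ge0.
  by rewrite phi_real// !lee_fin -!mulrA; apply/andP; split; lra.
Unshelve. all: by end_near. Qed.
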